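(* Let $0<\lambda<1$ and let $d$ be a fixed positive integer. Consider the $n$-queue supermarket model with parameters $\lambda,d$ started from the empty state $X_0^{(n)}=\mathbf{0}$. There is a constant $\theta>0$ such that, for $0 \le t\le \theta\ln n$, $$d_{\mathrm{TV}}\big(\mathcal{L}(X_t^{(n)}),\mathbf{\Pi}^{(n)}\big)=1-e^{-\Omega(\ln^2 n)};$$ that is, there exist constants $\theta>0$, $\gamma>0$ and $n_0$ such that for all $n\ge n_0$ and all $0\le t\le\theta\ln n$, $d_{\mathrm{TV}}(\mathcal{L}(X_t^{(n)}),\mathbf{\Pi}^{(n)})\ge 1-e^{-\gamma\ln^2 n}$.
   Context: Supermarket model with parameters $\lambda,d$: there are $n$ queues, each with a single server. Customers arrive in a Poisson process of rate $\lambda n$. On arrival each customer chooses a list of $d$ queues uniformly at random with replacement, and joins a shortest queue among those chosen (breaking ties by choosing the first of the shortest queues in the list). Service is first-come-first-served, and service times are independent exponential random variables with mean 1. $X_t^{(n)}=(X_t^{(n)}(1),\dots,X_t^{(n)}(n))$ is the queue-lengths vector at time $t$, where $X^{(n)}_t(j)$ is the number of customers in queue $j$ at time $t$ (including the one in service); sample paths are right-continuous. $(X_t^{(n)})_{t\ge0}$ is an ergodic continuous-time Markov chain on $(\mathbb{Z}_{\ge 0})^n$, and $\mathbf{\Pi}^{(n)}$ denotes its unique stationary distribution. $\mathbf{0}$ is the all-zero $n$-vector. $\mathcal{L}(X)$ denotes the law of $X$, $d_{\mathrm{TV}}(\mu_1,\mu_2)=\sup_A|\mu_1(A)-\mu_2(A)|$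 is the total variation distance, and $\ln^2 n=(\ln n)^2$. *)

(* Defs.v *)
From HB Require Import structures.
From mathcomp Require Import all_boot all_order all_algebra.
From mathcomp Require Import all_classical all_reals all_analysis.
Import Order.TTheory GRing.Theory Num.Theory.
Import numFieldNormedType.Exports.

Set Implicit Arguments.
Unset Strict Implicit.
Unset Printing Implicit Defensive.

Local Open Scope classical_set_scope.
Local Open Scope ring_scope.

Definition state (n : nat) : Type := {ffun 'I_n -> nat}.

Definition empty_state (n : nat) : state n := [ffun=> 0%N].

HB.instance Definition _ (n : nat) := Countable.on (state n).
HB.instance Definition _ (n : nat) := isPointed.Build (state n) (empty_state n).

(* The state space is countable and carries its discrete sigma-algebra. *)
HB.instance Definition _ (n : nat) :=
  @isMeasurable.Build default_measure_display (state n)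
    (@discrete_measurable (state n)) (@discrete_measurable0 (state n))
    (@discrete_measurableC (state n)) (@discrete_measurableU (state n)).

(* None only for the empty list. *)
Definition first_shortest (n : nat) (x : state n) (l : seq 'I_n) :
    option 'I_n :=
  ohead [seq j <- l | all (fun k => (x j <= x k)%N) l].

Definition arrive (n : nat) (x : state n) (l : seq 'I_n) : state n :=
  if first_shortest x l is Some j then [ffun i => (x i + (i == j))%N] else x.

Definition depart (n : nat) (x : state n) (j : 'I_n) : state n :=
  [ffun i => (x i - (i == j))%N].

(* Entry (x, y) of the Q-matrix. An event that moves x to x' at rate r
   contributes r * (1[x' = y] - 1[x = y]): each of the n ^ d lists is that of
   an arriving customer at rate lam * n / n ^ d, and each busy server completes
   a service at rate 1. Off the diagonal this is the total rate of the jumps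
   from x to y; the diagonal entry makes the rows sum to 0. *)
Definition supermarket_rate (R : realType) (lam : R) (d n : nat)
    (x y : state n) : R :=
  \sum_(l : d.-tuple 'I_n)
     lam * n%:R / n%:R ^+ d * ((arrive x l == y)%:R - (x == y)%:R) +
  \sum_(j < n | (0 < x j)%N) ((depart x j == y)%:R - (x == y)%:R).

(* Transition function, for times t >= 0, of the continuous-time Markov chain
   with the above rates: P(X_(s + t) \in A | X_s = x) = p t x A. The Q-matrix
   is bounded, so that it determines p on nonnegative times. *)
Record supermarket_transition (R : realType) (lam : R) (d n : nat)
    (p : R -> R.-pker (state n) ~> (state n)) : Prop := {
  transition0 : forall x : state n, p 0 x [set x] = 1%E ;
  transition_semigroup : forall (s t : R) (x : state n) (A : set (state n)),
    0 <= s -> 0 <= t -> p (s + t) x A = (\int[p s x]_y p t y A)%E ;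
  transition_rate : forall x y : state n,
    (fine (p h x [set y]) - (x == y)%:R) / h @[h --> 0^'+] -->
      supermarket_rate lam d x y }.

(* X is a Markov chain with transition function p, by its finite-dimensional
   distributions; only the times t >= 0 are meaningful. *)
Definition markov_chain (R : realType) (n : nat)
    (p : R -> R.-pker (state n) ~> (state n))
    (disp : measure_display) (Omega : measurableType disp)
    (P : probability Omega R) (X : R -> {RV P >-> state n}) : Prop :=
  forall (k : nat) (s : nat -> R) (x : nat -> state n),
    s 0%N = 0 -> {homo s : i j / (i <= j)%N >-> i <= j} ->
    P [set w | forall i, (i <= k)%N -> X (s i) w = x i] =
    (P [set w | X 0%R w = x 0%N] *
     \prod_(0 <= i < k) p (s i.+1 - s i)%R (x i) [set x i.+1])%E.

Definition right_continuous_paths (R : realType) (n : nat) (Omega : Type)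
    (X : R -> Omega -> state n) : Prop :=
  forall (w : Omega) (t : R), 0 <= t -> \forall s \near t^'+, X s w = X t w.

(* The process of queue lengths of the n-queue supermarket model. *)
Record supermarket_process (R : realType) (lam : R) (d n : nat)
    (p : R -> R.-pker (state n) ~> (state n))
    (disp : measure_display) (Omega : measurableType disp)
    (P : probability Omega R) (X : R -> {RV P >-> state n}) : Prop := {
  process_transition : supermarket_transition lam d p ;
  process_markov : markov_chain p X ;
  process_paths : right_continuous_paths (fun t w => X t w) }.

Definition stationary (R : realType) (n : nat)
    (p : R -> R.-pker (state n) ~> (state n))
    (Pi : probability (state n) R) : Prop :=
  forall (t : R) (A : set (state n)),
    0 <= t -> (\int[Pi]_x p t x A)%E = Pi A.

Definition dTV (R : realType) (disp : measure_display)
    (T : measurableType disp) (mu1 mu2 : probability T R) : \bar R :=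
  ereal_sup [set `|mu1 A - mu2 A|%E | A in measurable].

(* Main.v *)
(* Let f be the total number of customers and K the transition operator of the
   chain uniformised at rate q = (1 + lam) * n, so that the law at time t is the
   mixture of the laws of K^k under a Poisson variable k of mean q t. Coupling
   two queue vectors that differ by one customer shows that K preserves the
   functions which grow by at least 0 and at most 1 when a customer is added,
   and that one step multiplies a lower bound on this growth by at least
   (1 - 1/n)^d. Three facts follow for a_k = (K^k f)(0).
   - K e^(beta f) <= e^(beta K f + 2 beta^2), hence Gaussian concentration of f
     around K^k f after k steps, from any initial state.
   - K^k f >= a_k everywhere. Running the chain from Pi for a time at which at
     least k steps are made shows that f is under Pi at least about a_k, for
     every k, with no information on Pi other than its invariance.
   - a_(k+1) - a_k >= lam / (1 + lam) * (1 - 1/n)^(d k), so that a still grows by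
     n^(7/8), up to a constant, between M and M + n steps when M is about
     n ln n / (16 d).
   At times t <= theta ln n fewer than M steps have been made, so f is below the
   middle of a_M and a_(M + n), whereas it is above it under Pi. With
   beta = n^(-1/2) all error terms are smaller than e^(- ln^2 n) / 5. *)

Require Import Defs.
From HB Require Import structures.
From mathcomp Require Import all_boot all_order all_algebra.
From mathcomp Require Import all_classical all_reals all_analysis.
From mathcomp Require Import ring lra.
Import Order.TTheory GRing.Theory Num.Theory.
Import numFieldNormedType.Exports.

Set Implicit Arguments.
Unset Strict Implicit.
Unset Printing Implicit Defensive.

Local Open Scope classical_set_scope.
Local Open Scope ring_scope.

(** * Queue vectors that differ by one customer *)

Definition incr (n : nat) (x : state n) (j : 'I_n) : state n :=
  [ffun i => (x i + (i == j))%N].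

(** A smaller predicate only deletes candidates, so a first hit that survives stays first. This
    handles the tie-breaking rule when the set of shortest queues shrinks. *)
Lemma ohead_filter_sub (T : eqType) (a a' : pred T) (l : seq T) (i : T) :
  ohead [seq j <- l | a j] = Some i -> {in l, forall k, a' k -> a k} -> a' i ->
  ohead [seq j <- l | a' j] = Some i.
Proof.
elim: l => [//|k l IHl] /=.
case: ifP => [ak [<-] _ -> //|ak hl sub a'i].
rewrite ifN; last first.
  by apply/negP => /(sub k (mem_head _ _)); rewrite ak.
by apply: IHl => // j jl; apply: sub; rewrite inE jl orbT.
Qed.

Lemma first_shortest_exists (n : nat) (x : state n) (l : seq 'I_n) :
  l != [::] -> first_shortest x l != None.
Proof.
move=> l0; rewrite /first_shortest.
have [j jl jmin] : exists2 j, j \in l & all (fun k => x j <= x k)%N l.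
  elim: l l0 => [//|k l IHl] _.
  have [->|/IHl[j jl jmin]] := eqVneq l [::].
    by exists k; rewrite ?mem_head//= leqnn.
  have [kj|jk] := leqP (x k) (x j).
    exists k; rewrite ?mem_head//= leqnn /=.
    by apply/allP => i il; exact: leq_trans kj (allP jmin _ il).
  by exists j; rewrite ?inE ?jl ?orbT//= (ltnW jk).
have : j \in [seq j <- l | all (fun k => x j <= x k)%N l].
  by rewrite mem_filter jmin.
by case: [seq _ <- _ | _].
Qed.

Lemma first_shortest_in (n : nat) (x : state n) (l : seq 'I_n) (i : 'I_n) :
  first_shortest x l = Some i -> (i \in l) && all (fun k => x i <= x k)%N l.
Proof.
rewrite /first_shortest => h.
have : i \in [seq j <- l | all (fun k => x j <= x k)%N l].
  by move: h; case: [seq _ <- _ | _] => //= k s [->]; rewrite mem_head.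
by rewrite mem_filter andbC.
Qed.

Lemma arriveE (n : nat) (x : state n) (l : seq 'I_n) :
  arrive x l = if first_shortest x l is Some j then incr x j else x.
Proof. by []. Qed.

(** The chosen queue [i] keeps its length and remains a shortest one, and lengthening [j] creates no
    new minimiser; hence the choice does not change. *)
Lemma arrive_incr_neq (n : nat) (x : state n) (j : 'I_n) (l : seq 'I_n) :
  first_shortest x l != Some j -> arrive (incr x j) l = incr (arrive x l) j.
Proof.
rewrite !arriveE; have [->//|l0] := eqVneq l [::].
case fi: (first_shortest x l) (first_shortest_exists x l0) => [i|//] _ ij.
have /andP[il imin] := first_shortest_in fi.
have ->: first_shortest (incr x j) l = Some i.
  apply: (@ohead_filter_sub _ (fun k => all (fun m => x k <= x m)%N l)
    (fun k => all (fun m => incr x j k <= incr x j m)%N l)) fi _ _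
    => [k kl /allP kmin|].
    apply/allP => m ml; have := kmin _ il.
    rewrite !ffunE; have -> : (i == j) = false.
      by apply/negbTE; apply: contraNN ij => /eqP ->.
    rewrite addn0 => ki; rewrite (leq_trans (leq_addr _ _) (leq_trans ki _))//.
    exact: (allP imin).
  apply/allP => m ml; rewrite !ffunE.
  have -> : (i == j) = false.
    by apply/negbTE; apply: contraNN ij => /eqP ->.
  by rewrite addn0 (leq_trans (allP imin _ ml))// leq_addr.
by apply/ffunP => k; rewrite !ffunE addnAC.
Qed.

(** If [j] is the queue chosen from [x], then [arrive x l] is already [incr x j], and the arrival in
    the larger state adds one customer to it. *)
Lemma arrive_incr (n : nat) (x : state n) (j : 'I_n) (l : seq 'I_n) :
  arrive (incr x j) l = arrive x l \/
  exists k, arrive (incr x j) l = incr (arrive x l) k.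
Proof.
have [fj|fj] := eqVneq (first_shortest x l) (Some j); last first.
  by right; exists j; exact: arrive_incr_neq.
rewrite !arriveE fj; case: first_shortest => [k|]; last by left.
by right; exists k.
Qed.

Lemma arrive_incr_notin (n : nat) (x : state n) (j : 'I_n) (l : seq 'I_n) :
  j \notin l -> arrive (incr x j) l = incr (arrive x l) j.
Proof.
move=> jl; apply: arrive_incr_neq; apply: contraNN jl => /eqP.
by move=> /first_shortest_in/andP[].
Qed.

Lemma arrive_step (n : nat) (x : state n) (l : seq 'I_n) :
  arrive x l = x \/ exists k, arrive x l = incr x k.
Proof.
by rewrite arriveE; case: first_shortest => [k|]; [right; exists k|left].
Qed.

Lemma arrive_nonempty (n : nat) (x : state n) (l : seq 'I_n) :
  l != [::] -> exists k, arrive x l = incr x k.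
Proof.
move=> /(first_shortest_exists x); rewrite arriveE.
by case: first_shortest => // k _; exists k.
Qed.

Lemma incr_depart (n : nat) (x : state n) (j : 'I_n) :
  (0 < x j)%N -> incr (depart x j) j = x.
Proof.
move=> xj; apply/ffunP => i; rewrite !ffunE.
by have [->|_] := eqVneq i j; rewrite ?subnK// subn0 addn0.
Qed.

Lemma depart0 (n : nat) (x : state n) (j : 'I_n) : x j = 0%N -> depart x j = x.
Proof.
move=> xj; apply/ffunP => i; rewrite !ffunE.
by have [->|_] := eqVneq i j; rewrite ?xj// subn0.
Qed.

Lemma depart_incr_eq (n : nat) (x : state n) (j : 'I_n) :
  depart (incr x j) j = x.
Proof. by apply/ffunP => i; rewrite !ffunE addnK. Qed.

Lemma depart_incr_neq (n : nat) (x : state n) (i j : 'I_n) :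
  i != j -> depart (incr x j) i = incr (depart x i) j.
Proof.
move=> ij; apply/ffunP => k; rewrite !ffunE.
have [->|ki] := eqVneq k i; last by rewrite !subn0.
by rewrite (negbTE ij) !addn0.
Qed.

(** The two vectors merge only if the service is at [j] and that queue holds nobody but the extra
    customer. *)
Lemma depart_incr (n : nat) (x : state n) (i j : 'I_n) :
  depart (incr x j) i = depart x i \/
  exists k, depart (incr x j) i = incr (depart x i) k.
Proof.
have [->|ij] := eqVneq i j; last first.
  by right; exists j; exact: depart_incr_neq.
rewrite depart_incr_eq; have [x0|x0] := posnP (x j).
  by left; rewrite depart0.
by right; exists j; rewrite incr_depart.
Qed.

Lemma depart_step (n : nat) (x : state n) (j : 'I_n) :
  depart x j = x \/ exists k, x = incr (depart x j) k.
Proof.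
have [x0|x0] := posnP (x j); first by left; rewrite depart0.
by right; exists j; rewrite incr_depart.
Qed.

Definition customers (n : nat) (x : state n) : nat := (\sum_j x j)%N.

Lemma customers_incr (n : nat) (x : state n) (j : 'I_n) :
  customers (incr x j) = (customers x).+1.
Proof.
rewrite /customers; under eq_bigr do rewrite ffunE.
rewrite big_split /= -addn1; congr addn.
rewrite (bigD1 j)//= eqxx big1// => i /negbTE ->//.
Qed.

Lemma state_ind (n : nat) (P : state n -> Prop) :
  P (empty_state n) -> (forall x j, P x -> P (incr x j)) -> forall x, P x.
Proof.
move=> P0 Pincr x; have [m] := ubnP (customers x).
elim: m x => // m IHm x xm.
have [/forallP/= x0|/forallPn/=[j]] := boolP [forall j, x j == 0%N].
  suff -> : x = empty_state n by [].
  by apply/ffunP => j; rewrite ffunE (eqP (x0 j)).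
rewrite -lt0n => xj; rewrite -(incr_depart xj); apply/Pincr/IHm.
by move: xm; rewrite -{1}(incr_depart xj) customers_incr.
Qed.

(* One step of the chain uniformised at rate (1 + lam) * n: the generator is
   (1 + lam) * n times (jump - id). A service completion at an empty queue is
   a null step, because of the truncated subtraction in depart. *)
Definition jump (R : realType) (lam : R) (d n : nat) (g : state n -> R)
    (x : state n) : R :=
  lam / (1 + lam) * ((\sum_(l : d.-tuple 'I_n) g (arrive x l)) / n%:R ^+ d) +
  (1 + lam)^-1 * ((\sum_(j < n) g (depart x j)) / n%:R).

Arguments jump {R} lam d {n} g x.

(** * Order and affine properties of the uniformised step *)

(** Both states are fed the same list or the same server (synchronous coupling). The functions [a]
    and [b] record the gain of each event, and their average is gained overall. *)
Lemma ler_jump_couple (R : realType) (lam : R) (d n : nat)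
    (g h : state n -> R) (x y : state n)
    (a : d.-tuple 'I_n -> R) (b : 'I_n -> R) : 0 < lam ->
  (forall l : d.-tuple 'I_n, g (arrive x l) + a l <= h (arrive y l)) ->
  (forall j, g (depart x j) + b j <= h (depart y j)) ->
  jump lam d g x + (lam / (1 + lam) * ((\sum_l a l) / n%:R ^+ d) +
    (1 + lam)^-1 * ((\sum_j b j) / n%:R)) <= jump lam d h y.
Proof.
move=> lam0 ha hb.
rewrite /jump addrACA -!mulrDr -!mulrDl -!big_split /=.
have l1 : 0 < 1 + lam by rewrite addr_gt0.
apply: lerD.
- apply: ler_wpM2l; first by rewrite divr_ge0 ?ltW.
  by apply: ler_wpM2r; [rewrite invr_ge0 exprn_ge0|apply: ler_sum => l _].
- apply: ler_wpM2l; first by rewrite invr_ge0 ltW.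
  by apply: ler_wpM2r; [rewrite invr_ge0|apply: ler_sum => j _].
Qed.

Lemma jump_affine (R : realType) (lam : R) (d n : nat) (g : state n -> R)
    (a b : R) (x : state n) : 0 < lam -> (0 < n)%N ->
  jump lam d (fun y => a * g y + b) x = a * jump lam d g x + b.
Proof.
move=> lam0 n0; rewrite /jump !big_split /= -!mulr_sumr !sumr_const.
rewrite card_tuple card_ord.
have l1 : 1 + lam != 0 by rewrite gt_eqF ?addr_gt0.
have n1 : n%:R != 0 :> R by rewrite pnatr_eq0 -lt0n.
have nd : n%:R ^+ d != 0 :> R by rewrite expf_neq0.
rewrite -[b *+ _]mulr_natr -[b *+ n]mulr_natr natrX.
by field; rewrite l1 n1 nd.
Qed.

Lemma jump_linear (R : realType) (lam : R) (d n : nat) (a : R)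
    (g h : state n -> R) (x : state n) :
  jump lam d (fun y => a * g y + h y) x = a * jump lam d g x + jump lam d h x.
Proof. by rewrite /jump !big_split /= -!mulr_sumr; ring. Qed.

Lemma jump_cst (R : realType) (lam : R) (d n : nat) (b : R) (x : state n) :
  0 < lam -> (0 < n)%N -> jump lam d (fun=> b) x = b.
Proof.
move=> lam0 n0; have := @jump_affine R lam d n (fun=> 0) 0 b x lam0 n0.
by rewrite !mul0r !add0r.
Qed.

(** The comparison is required only at states reached from [x] in one event, since the exponential
    bound below holds only near [x]. *)
Lemma ler_jump_step (R : realType) (lam : R) (d n : nat)
    (g h : state n -> R) (x : state n) : 0 < lam ->
  (forall l : d.-tuple 'I_n, g (arrive x l) <= h (arrive x l)) ->
  (forall j, g (depart x j) <= h (depart x j)) ->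
  jump lam d g x <= jump lam d h x.
Proof.
move=> lam0 ga gd.
have := @ler_jump_couple R lam d n g h x x (fun=> 0) (fun=> 0) lam0.
rewrite !big1// !mul0r !mulr0 !addr0; apply => [l|j]; rewrite addr0.
  exact: ga.
exact: gd.
Qed.

Lemma ler_jump (R : realType) (lam : R) (d n : nat)
    (g h : state n -> R) (x : state n) : 0 < lam ->
  (forall y, g y <= h y) -> jump lam d g x <= jump lam d h x.
Proof. by move=> lam0 gh; apply: ler_jump_step. Qed.

Lemma ler_iter_jump (R : realType) (lam : R) (d n k : nat)
    (g h : state n -> R) : 0 < lam ->
  (forall y, g y <= h y) ->
  forall x, iter k (jump lam d) g x <= iter k (jump lam d) h x.
Proof.
by move=> lam0 gh; elim: k => //= k IHk x; apply: ler_jump.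
Qed.

Lemma iter_jump_affine (R : realType) (lam : R) (d n k : nat)
    (g : state n -> R) (a b : R) (x : state n) : 0 < lam -> (0 < n)%N ->
  iter k (jump lam d) (fun y => a * g y + b) x =
  a * iter k (jump lam d) g x + b.
Proof.
move=> lam0 n0; elim: k x => //= k IHk x.
rewrite -jump_affine//; congr (jump _ _ _ _).
by apply/funext => y; exact: IHk.
Qed.

(** * Growth when one customer is added *)

(** Only the lower bound is a parameter: it decays from step to step, whereas the upper bound 1 is
    preserved. *)
Definition increments_in (R : realType) (n : nat) (delta : R)
    (g : state n -> R) : Prop :=
  forall x j, g x + delta <= g (incr x j) <= g x + 1.

(* The probability that a list of d queues misses a given queue. *)
Definition avoidance (R : realType) (d n : nat) : R := (n.-1%:R / n%:R) ^+ d.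

Lemma avoidance_ge0 (R : realType) (d n : nat) : 0 <= avoidance R d n.
Proof. by rewrite exprn_ge0 ?divr_ge0. Qed.

(** Lists over [n.-1] queues embed through [lift j], whose image misses [j]. *)
Lemma card_tuple_avoiding (d n : nat) (j : 'I_n) :
  (n.-1 ^ d <= #|[pred l : d.-tuple 'I_n | j \notin l]|)%N.
Proof.
pose F (t : d.-tuple 'I_n.-1) := map_tuple (lift j) t.
have Finj : injective F.
  move=> s t /(congr1 val)/= /inj_map st.
  by apply/val_inj/st; exact: lift_inj.
rewrite -[X in (X ^ d)%N]card_ord -card_tuple -(card_codom Finj).
apply/subset_leq_card/fintype.subsetP => _ /codomP[t ->].
by rewrite inE; apply/mapP => -[k _ /eqP]; rewrite (negbTE (neq_lift _ _)).
Qed.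

(** Under the coupling the two states still differ by at most one customer, which gives the upper
    bound. The growth [delta] is certain when the list misses [j] or when another server than [j]
    completes; every other event contributes at least 0. *)
Lemma jump_increments (R : realType) (lam : R) (d n : nat) (delta : R)
    (g : state n -> R) : 0 < lam -> (0 < d)%N -> 0 <= delta ->
  increments_in delta g ->
  increments_in (delta * avoidance R d n) (jump lam d g).
Proof.
move=> lam0 d0 delta0 gP x j.
have n0 : (0 < n)%N by apply: leq_ltn_trans (ltn_ord j).
have nR : 0 < n%:R :> R by rewrite ltr0n.
have l1 : 0 < 1 + lam by rewrite addr_gt0.
have dle1 : delta <= 1 by have /andP[] := gP x j; lra.
have gle y k : g y <= g (incr y k) by have /andP[] := gP y k; lra.
have g1 y k : g (incr y k) <= g y + 1 by have /andP[] := gP y k.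
have gd y k : g y + delta <= g (incr y k) by have /andP[] := gP y k.
apply/andP; split; last first.
  rewrite -[leRHS]mul1r mul1r -[X in _ <= X + _]mul1r -jump_affine//.
  have := @ler_jump_couple R lam d n g (fun y => 1 * g y + 1) (incr x j) x
    (fun=> 0) (fun=> 0) lam0.
  rewrite !big1// !mul0r !mulr0 !addr0; apply => [l|i]; rewrite addr0 mul1r.
    by have [->|[k ->]] := arrive_incr x j l; rewrite ?lerDl.
  by have [->|[k ->]] := depart_incr x i j; rewrite ?lerDl.
apply: le_trans (@ler_jump_couple R lam d n g g x (incr x j)
  (fun l => delta * (j \notin l)%:R) (fun i => delta * (i != j)%:R) lam0 _ _).
- rewrite lerD2l.
  set p := avoidance R d n.
  have -> : delta * p = lam / (1 + lam) * (delta * p) +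
      (1 + lam)^-1 * (delta * p).
    by rewrite -mulrDl -[X in _ + X]mul1r -mulrDl addrC divff ?gt_eqF ?mul1r.
  apply: lerD.
    apply: ler_wpM2l; first by rewrite divr_ge0 ?ltW.
    rewrite -mulr_sumr -mulrA; apply: ler_wpM2l => //.
    rewrite /p /avoidance expr_div_n; apply: ler_wpM2r.
      by rewrite invr_ge0 exprn_ge0.
    rewrite -natr_sum -natrX ler_nat.
    apply: leq_trans (card_tuple_avoiding d j) _.
    rewrite -sum1_card big_mkcond; apply: leq_sum => l _.
    by rewrite inE; case: ifP.
  apply: ler_wpM2l; first by rewrite invr_ge0 ltW.
  rewrite -mulr_sumr -mulrA; apply: ler_wpM2l => //.
  have -> : \sum_(i < n) (i != j)%:R = n.-1%:R :> R.
    rewrite -natr_sum -[n in n.-1]card_ord -(cardC1 j) -sum1_card [in RHS]big_mkcond.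
    by congr (_%:R); apply: eq_bigr => i _; rewrite inE; case: (i != j).
  (* A server other than [j] is picked with probability [n.-1 / n], which is at least its [d]-th
     power because [d] is positive. *)
  have p01 : 0 <= (n.-1%:R / n%:R : R) <= 1.
    by rewrite divr_ge0//= ler_pdivrMr// mul1r ler_nat leq_pred.
  by case: d d0 @p => // d _ p; rewrite /p /avoidance exprS ler_piMr ?exprn_ile1;
    case/andP: p01.
- move=> l; case: (boolP (j \in l)) => jl /=; last first.
    by rewrite mulr1 arrive_incr_notin.
  rewrite mulr0 addr0; by have [->|[k ->]] := arrive_incr x j l.
- move=> i; have [->|ij] := eqVneq i j => /=; last by rewrite mulr1 depart_incr_neq.
  rewrite mulr0 addr0; by have [->|[k ->]] := depart_incr x j j.
Qed.

Lemma iter_jump_increments (R : realType) (lam : R) (d n k : nat)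
    (g : state n -> R) : 0 < lam -> (0 < d)%N -> increments_in 1 g ->
  increments_in (avoidance R d n ^+ k) (iter k (jump lam d) g).
Proof.
move=> lam0 d0 g1; elim: k => [|k IHk]; first by rewrite expr0.
by rewrite iterS exprSr; apply: jump_increments => //; rewrite exprn_ge0 ?avoidance_ge0.
Qed.

Lemma increments_in_weaken (R : realType) (n : nat) (delta : R)
    (g : state n -> R) : 0 <= delta -> increments_in delta g ->
  increments_in 0 g.
Proof. by move=> d0 gP x j; have /andP[g1 g2] := gP x j; apply/andP; lra. Qed.

(** * Exponential moments *)

(** From [1 - z <= expR (- z)] one gets [expR z * (1 - z) <= 1], while [(1 - z) * (1 + z + 2 * z ^+
    2) = 1 + z ^+ 2 * (1 - 2 * z)] is at least 1. *)
Lemma expR_le_quadratic (R : realType) (z : R) :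
  z <= 1 / 2 -> expR z <= 1 + z + 2 * z ^+ 2.
Proof.
move=> z2; have h := expR_ge1Dx (- z).
have p := expR_gt0 z; have e : expR z * expR (- z) = 1.
  by rewrite -expRD subrr expR0.
have : expR z * (1 - z) <= 1 by rewrite -[leRHS]e ler_pM2l.
by nra.
Qed.

(** One event moves [F] by at most 1, so the quadratic bound dominates the exponential by an affine
    function of [F], on which [jump] acts exactly. Then [1 + u <= expR u] restores an
    exponential. *)
Lemma jump_expR (R : realType) (lam beta : R) (d n : nat)
    (F : state n -> R) (x : state n) : 0 < lam -> (0 < n)%N ->
  `|beta| <= 1 / 2 -> increments_in 0 F ->
  jump lam d (fun y => expR (beta * F y)) x <=
  expR (beta * jump lam d F x + 2 * beta ^+ 2).
Proof.
move=> lam0 n0 b2 FP.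
have step y : `|F y - F x| <= 1 ->
    expR (beta * F y) <= (expR (beta * F x) * beta) * F y +
      expR (beta * F x) * (1 - beta * F x + 2 * beta ^+ 2).
  move=> yx; set z := beta * (F y - F x).
  have zle : `|z| <= `|beta| by rewrite normrM ler_piMr.
  have z2 : z ^+ 2 <= beta ^+ 2.
    rewrite -[leLHS]real_normK ?num_real// -[leRHS]real_normK ?num_real//.
    by rewrite lerXn2r ?nnegrE.
  have -> : beta * F y = beta * F x + z by rewrite /z; lra.
  rewrite expRD -mulrA -mulrDr ler_pM2l ?expR_gt0//.
  apply: le_trans (expR_le_quadratic _) _.
    exact: le_trans (le_trans (ler_norm _) zle) b2.
  by rewrite /z in z2 *; lra.
have adj y z k : z = incr y k -> `|F z - F y| <= 1.
  by move=> ->; rewrite ler_norml; have /andP[] := FP y k; lra.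
apply: le_trans (ler_jump_step (h := fun y => (expR (beta * F x) * beta) * F y +
      expR (beta * F x) * (1 - beta * F x + 2 * beta ^+ 2)) lam0 _ _) _.
- move=> l; apply: step; have [->|[k]] := arrive_step x l.
    by rewrite subrr normr0.
  exact: adj.
- move=> j; apply: step; have [->|[k]] := depart_step x j.
    by rewrite subrr normr0.
  by rewrite distrC; exact: adj.
rewrite jump_affine// -mulrA -mulrDr.
rewrite [X in _ <= expR X](_ : _ = beta * F x +
  (beta * (jump lam d F x - F x) + 2 * beta ^+ 2)); last by lra.
rewrite expRD ler_pM2l ?expR_gt0//.
by apply: le_trans (expR_ge1Dx _); lra.
Qed.

(** All iterates of [f] have increments between 0 and 1, so every step costs the same
    [2 * beta ^+ 2]. *)
Lemma iter_jump_expR (R : realType) (lam beta : R) (d n k : nat)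
    (f : state n -> R) (x : state n) : 0 < lam -> (0 < d)%N -> (0 < n)%N ->
  `|beta| <= 1 / 2 -> increments_in 1 f ->
  iter k (jump lam d) (fun y => expR (beta * f y)) x <=
  expR (beta * iter k (jump lam d) f x + k%:R * (2 * beta ^+ 2)).
Proof.
move=> lam0 d0 n0 b2 f1; elim: k x => [|k IHk] x; first by rewrite mul0r addr0.
rewrite !iterS; apply: le_trans (ler_jump d x lam0 IHk) _.
set F := iter k (jump lam d) f.
set c := k%:R * _.
have -> : jump lam d (fun y => expR (beta * F y + c)) x =
    expR c * jump lam d (fun y => expR (beta * F y)) x.
  rewrite -[RHS]addr0 -jump_affine//; congr (jump _ _ _ _).
  by apply/funext => y; rewrite expRD mulrC addr0.
rewrite [X in _ <= expR X](_ : _ = c + (beta * jump lam d F x + 2 * beta ^+ 2)).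
  rewrite expRD ler_pM2l ?expR_gt0//; apply: jump_expR => //.
  apply: increments_in_weaken (iter_jump_increments k lam0 d0 f1).
  by rewrite exprn_ge0 ?avoidance_ge0.
by rewrite /c -natr1; lra.
Qed.

(** * Expected number of customers from the empty state *)

Lemma iter_jump_ge_empty (R : realType) (lam : R) (d n k : nat)
    (f : state n -> R) (x : state n) : 0 < lam -> (0 < d)%N ->
  increments_in 1 f ->
  iter k (jump lam d) f (empty_state n) <= iter k (jump lam d) f x.
Proof.
move=> lam0 d0 f1; elim/state_ind: x => // x j; move/le_trans; apply.
have /andP[h _] := iter_jump_increments k lam0 d0 f1 x j.
by apply: le_trans h; rewrite lerDl exprn_ge0 ?avoidance_ge0.
Qed.

(** The outermost [jump] is the first step. From the empty state services do nothing, and an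
    arrival, of probability [lam / (1 + lam)], adds a customer who is worth at least
    [avoidance R d n ^+ k] after [k] more steps. *)
Lemma iter_jump_empty_incr (R : realType) (lam : R) (d n k : nat)
    (f : state n -> R) : 0 < lam -> (0 < d)%N -> (0 < n)%N ->
  increments_in 1 f ->
  iter k (jump lam d) f (empty_state n) + lam / (1 + lam) * avoidance R d n ^+ k
  <= iter k.+1 (jump lam d) f (empty_state n).
Proof.
move=> lam0 d0 n0 f1; rewrite iterS; set F := iter k _ _.
set e := empty_state n; set delta := _ ^+ k.
have F1 : increments_in delta F by exact: iter_jump_increments.
have := @ler_jump_couple R lam d n (fun=> F e) F e e (fun=> delta) (fun=> 0) lam0.
rewrite jump_cst// !sumr_const card_tuple card_ord mul0rn mul0r mulr0 !addr0.
rewrite -[delta *+ _]mulr_natr natrX mulfK; last first.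
  by rewrite expf_neq0// pnatr_eq0 -lt0n.
apply => [l|j].
  have [|k' ->] := @arrive_nonempty n e l.
    by rewrite -size_eq0 size_tuple -lt0n.
  by have /andP[] := F1 e k'.
by rewrite depart0// ffunE.
Qed.

(** Since [avoidance] is at most 1, the power [k + m] bounds each of the [m] increments from
    below. *)
Lemma iter_jump_empty_gap (R : realType) (lam : R) (d n k m : nat)
    (f : state n -> R) : 0 < lam -> (0 < d)%N -> (0 < n)%N ->
  increments_in 1 f ->
  iter k (jump lam d) f (empty_state n) +
    m%:R * (lam / (1 + lam) * avoidance R d n ^+ (k + m))
  <= iter (k + m) (jump lam d) f (empty_state n).
Proof.
move=> lam0 d0 n0 f1.
have a0 : 0 <= avoidance R d n := avoidance_ge0 R d n.
have a1 : avoidance R d n <= 1.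
  rewrite exprn_ile1 ?divr_ge0// ler_pdivrMr ?ltr0n// mul1r ler_nat.
  exact: leq_pred.
have l0 : 0 <= lam / (1 + lam) by rewrite divr_ge0 ?ltW ?addr_gt0.
elim: m => [|m IHm]; first by rewrite mul0r addr0 addn0.
rewrite addnS; apply: le_trans (iter_jump_empty_incr (k + m) lam0 d0 n0 f1).
apply: le_trans (lerD IHm (lexx _)); rewrite -addrA lerD2l.
rewrite -natr1 mulrDl mul1r exprSr.
have p : avoidance R d n ^+ (k + m) * avoidance R d n <= avoidance R d n ^+ (k + m).
  by rewrite ler_piMr ?exprn_ge0.
apply: lerD; last by rewrite ler_wpM2l.
by apply: ler_wpM2l => //; rewrite ler_wpM2l.
Qed.

Lemma customers_increments (R : realType) (n : nat) :
  increments_in 1 (fun x : state n => (customers x)%:R : R).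
Proof. by move=> x j; rewrite customers_incr -natr1 lexx. Qed.

(** * Poisson tails and a comparison of primitives *)

Lemma sum_exp_coeff_le (R : realType) (s : R) (m : nat) : 0 <= s ->
  \sum_(0 <= k < m) exp_coeff s k <= expR s.
Proof.
move=> s0; rewrite /expR.
apply: (@nondecreasing_cvgn_le _ (series (exp_coeff s))); last first.
  exact: is_cvg_series_exp_coeff.
apply/nondecreasing_seqP => k; rewrite /series /= big_nat_recr//= lerDl.
by rewrite /exp_coeff /= divr_ge0 ?exprn_ge0.
Qed.

(** Chernoff bound with ratio 2: for [m <= k], [s ^+ k] is at most [2 ^- m * (2 * s) ^+ k]. *)
Lemma sum_exp_coeff_ge (R : realType) (s : R) (m : nat) : 0 <= s ->
  expR s - 2 ^- m * expR (2 * s) <= \sum_(0 <= k < m) exp_coeff s k.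
Proof.
move=> s0; rewrite lerBlDr [X in X <= _]/expR.
apply: limr_le; first exact: is_cvg_series_exp_coeff.
near=> N; have mN : (m <= N)%N by near: N; exists m.
rewrite /series/= (big_cat_nat (leq0n m) mN)//= lerD2l.
have s20 : 0 <= 2 * s by rewrite mulr_ge0.
apply: le_trans (ler_wpM2l _ (sum_exp_coeff_le N s20)); last first.
  by rewrite invr_ge0 exprn_ge0.
rewrite [X in _ <= _ * X](big_cat_nat (leq0n m) mN)//= mulrDr.
apply: (@le_trans _ _ (2 ^- m * \sum_(m <= k < N) exp_coeff (2 * s) k)).
  rewrite mulr_sumr; apply: ler_sum_nat => k /andP[mk _].
  rewrite /exp_coeff/= mulrA; apply: ler_wpM2r; first by rewrite invr_ge0.
  rewrite exprMn mulrA ler_peMl ?exprn_ge0// mulrC ler_pdivlMr ?exprn_gt0//.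
  by rewrite mul1r ler_weXn2l// ler1n.
rewrite lerDr mulr_ge0 ?invr_ge0 ?exprn_ge0// sumr_ge0// => k _.
by rewrite /exp_coeff /= divr_ge0 ?exprn_ge0.
Unshelve. all: by end_near. Qed.

(** The lower tail is treated with ratio 1/2: for [k < l], [s ^+ k] is at most
    [2 ^+ l * (s / 2) ^+ k]. *)
Lemma poisson_window (R : realType) (s : R) (l m : nat) : 0 <= s ->
  (l <= m)%N ->
  1 - 2 ^+ l * expR (- (s / 2)) - 2 ^- m * expR s <=
  expR (- s) * \sum_(l <= k < m) exp_coeff s k.
Proof.
move=> s0 lm; have := sum_exp_coeff_ge m s0; rewrite (big_cat_nat (leq0n l) lm)//=.
have lo : \sum_(0 <= k < l) exp_coeff s k <= 2 ^+ l * expR (s / 2).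
  have s20 : 0 <= s / 2 by rewrite divr_ge0.
  apply: le_trans (ler_wpM2l _ (sum_exp_coeff_le l s20)); last exact: exprn_ge0.
  rewrite mulr_sumr; apply: ler_sum_nat => k /andP[_ kl].
  rewrite /exp_coeff/= mulrA; apply: ler_wpM2r; first by rewrite invr_ge0.
  rewrite exprMn exprVn mulrCA ler_peMr ?exprn_ge0// ler_pdivlMr ?exprn_gt0//.
  by rewrite mul1r ler_weXn2l ?ler1n// ltnW.
move=> h; have {h lo} : expR s - 2 ^- m * expR (2 * s) - 2 ^+ l * expR (s / 2) <=
    \sum_(l <= k < m) exp_coeff s k by lra.
move=> /(ler_wpM2l (expR_ge0 (- s))); apply: le_trans.
have e1 : expR (- s) * expR s = 1 by rewrite -expRD addNr expR0.
have e2 : expR (- s) * expR (2 * s) = expR s by rewrite -expRD; congr expR; lra.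
have e3 : expR (- s) * expR (s / 2) = expR (- (s / 2)).
  by rewrite -expRD; congr expR; lra.
rewrite !mulrBr e1 mulrCA e2 [X in _ <= _ - X]mulrCA e3.
by lra.
Qed.

(* The first hypothesis, being uniform in t, allows Riemann sums of mesh T / N
   and so replaces the differentiability of F. *)
Lemma lower_primitive_bound (R : realType) (F G H : R -> R) (T : R) : 0 <= T ->
  (forall e, 0 < e -> exists2 delta, 0 < delta & forall t h, 0 <= t ->
     0 < h < delta -> t + h <= T -> F t + h * G t - e * h <= F (t + h)) ->
  (forall a b, 0 <= a -> a <= b -> H b - H a <= (b - a) * G b) ->
  0 <= G 0 -> H 0 <= F 0 -> H T <= F T.
Proof.
move=> T0 Fstep Hstep G0 HF0; have [->//|Tn0] := eqVneq T 0.
have {Tn0}T0' : 0 < T by rewrite lt_def Tn0.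
apply/ler_addgt0Pr => e e0.
have [|delta delta0 Fd] := Fstep (e / (2 * T)); first by rewrite divr_gt0 ?mulr_gt0.
(* With more than [c] subintervals, the mesh is below [delta] and [h * G T] is at most [e / 2]. *)
set c := T / delta + 2 * T * `|G T| / e.
have c0 : 0 <= c.
  by rewrite addr_ge0 ?divr_ge0 ?mulr_ge0// ltW.
pose N := (Num.trunc c).+1; pose h := T / N%:R.
have N0 : 0 < N%:R :> R by rewrite ltr0n.
have cN : c < N%:R by exact: truncnS_gt.
have h0 : 0 < h by rewrite divr_gt0.
have hN : N%:R * h = T by rewrite /h mulrC divfK// gt_eqF.
have hdelta : h < delta.
  rewrite ltr_pdivrMr// mulrC -ltr_pdivrMr//; apply: le_lt_trans cN.
  by rewrite lerDl divr_ge0 ?mulr_ge0// ltW.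
have hG : h * G T <= e / 2.
  rewrite (le_trans (ler_wpM2l (ltW h0) (ler_norm _)))//.
  have : 2 * T * `|G T| / e <= N%:R.
    by apply: le_trans (ltW cN); rewrite lerDr divr_ge0 ?ltW.
  rewrite ler_pdivrMr// => hh.
  by rewrite /h mulrAC ler_pdivrMr//; lra.
(* [F] grows by [h * G] taken at the left end and [H] by at most [h * G] taken at the right end. The
   term [h * G] makes this mismatch telescope. *)
have main i : (i <= N)%N ->
    - (e / (2 * T)) * (i%:R * h) <= F (i%:R * h) - H (i%:R * h) + h * G (i%:R * h).
  elim: i => [_|i IHi iN].
    rewrite mul0r mulr0 addr_ge0 ?subr_ge0// mulr_ge0// ltW//.
  have {}IHi := IHi (ltnW iN).
  have i0 : 0 <= i%:R * h by rewrite mulr_ge0// ltW.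
  have eS : i.+1%:R * h = i%:R * h + h by rewrite -natr1 mulrDl mul1r.
  have iT : i%:R * h + h <= T by rewrite -eS -hN ler_pM2r// ler_nat.
  have h1 : 0 < h < delta by rewrite h0.
  have f1 := Fd _ h i0 h1 iT.
  have := Hstep (i%:R * h) (i%:R * h + h) i0 _.
  rewrite lerDl ltW// => /(_ isT); rewrite eS.
  by move: (F _) (F _) (H _) (H _) (G _) (G _) f1 IHi => *; lra.
have := main N (leqnn _); rewrite hN.
have -> : - (e / (2 * T)) * T = - (e / 2) by field; rewrite gt_eqF.
by lra.
Qed.

(** * Short-time behaviour of the transition function *)

Lemma kernel_fineK (R : realType) (n : nat)
    (k : R.-pker (state n) ~> (state n)) (x : state n) (A : set (state n)) :
  (fine (k x A))%:E = k x A.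
Proof.
rewrite fineK// ge0_fin_numE//.
rewrite (@le_lt_trans _ _ 1%E) ?ltry// -(prob_kernel (s := k) x).
by apply: le_measure; rewrite ?inE.
Qed.

Lemma fine_kernel_le1 (R : realType) (n : nat)
    (k : R.-pker (state n) ~> (state n)) (x : state n) (A : set (state n)) :
  0 <= fine (k x A) <= 1.
Proof.
rewrite fine_ge0//= -lee_fin kernel_fineK -(prob_kernel (s := k) x).
by apply: le_measure; rewrite ?inE.
Qed.

Lemma fine_kernelC (R : realType) (n : nat)
    (k : R.-pker (state n) ~> (state n)) (x : state n) (A : set (state n)) :
  fine (k x (~` A)) = 1 - fine (k x A).
Proof.
apply/EFin_inj; rewrite EFinB !kernel_fineK -(prob_kernel (s := k) x).
rewrite -[in LHS]setTD measureD ?setTI//.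
have h : (k x [set: state n] < +oo)%E by rewrite -kernel_fineK ltry.
exact: h.
Qed.

(** Dropping the intermediate states outside [S] loses only nonnegative mass, so the semigroup
    identity yields a finite lower bound. *)
Lemma transition_ge_sum (R : realType) (lam : R) (d n : nat)
    (p : R -> R.-pker (state n) ~> (state n)) (A : set (state n))
    (S : seq (state n)) (s t : R) (x : state n) :
  supermarket_transition lam d p -> 0 <= s -> 0 <= t -> uniq S ->
  \sum_(y <- S) fine (p s x [set y]) * fine (p t y A) <= fine (p (s + t) x A).
Proof.
move=> pP s0 t0 uS; rewrite -lee_fin kernel_fineK (transition_semigroup pP)//.
pose f y z := ((fine (p t y A))%:E * (\1_[set y] z)%:E)%E.
have f0 y z : (0 <= f y z)%E.
  by rewrite mule_ge0 ?lee_fin//; have /andP[] := fine_kernel_le1 (p t) y A.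
apply: (@le_trans _ _ (\int[p s x]_z (\sum_(y <- S) f y z))%E).
  rewrite ge0_integral_sum//.
  rewrite -sumEFin; apply: lee_sum => y _.
  rewrite /f ge0_integralZl//.
  by rewrite integral_indic// setIT -[p s x _]kernel_fineK -EFinM mulrC.
apply: ge0_le_integral => //.
- by move=> z _; apply: sume_ge0.
- move=> z _; have [zS|zS] := boolP (z \in S); last first.
    rewrite big1_seq// => y /andP[_ yS]; rewrite /f indicE.
    rewrite memNset ?mule0//= => zy; move: zS; rewrite zy yS //.
  rewrite (bigD1_seq z)//= big1 ?adde0.
    by rewrite /f indicE mem_set// mule1 kernel_fineK.
  move=> y yz; rewrite /f indicE memNset ?mule0//= => zy.
  by move: yz; rewrite zy eqxx.
Qed.

Lemma sum_indicator_diff (R : realType) (n : nat) (S : seq (state n))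
    (phi : state n -> R) (x y : state n) : uniq S -> x \in S -> y \in S ->
  \sum_(z <- S) ((y == z)%:R - (x == z)%:R) * phi z = phi y - phi x.
Proof.
move=> uS xS yS; have one w : w \in S -> \sum_(z <- S) (w == z)%:R * phi z = phi w.
  move=> wS; rewrite (bigD1_seq w)//= eqxx mul1r big1 ?addr0// => z.
  by rewrite eq_sym => /negbTE ->; rewrite mul0r.
by under eq_bigr do rewrite mulrBl; rewrite sumrB !one.
Qed.

(** As [S] contains [x] and all its successors, the sum is the generator applied to [phi]. *)
Lemma sum_rate (R : realType) (lam : R) (d n : nat) (S : seq (state n))
    (phi : state n -> R) (x : state n) : 0 < lam -> (0 < n)%N ->
  uniq S -> x \in S -> (forall l : d.-tuple 'I_n, arrive x l \in S) ->
  (forall j, depart x j \in S) ->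
  \sum_(y <- S) supermarket_rate lam d x y * phi y =
  (1 + lam) * n%:R * (jump lam d phi x - phi x).
Proof.
move=> lam0 n0 uS xS aS dS; rewrite /supermarket_rate.
under eq_bigr do rewrite mulrDl !mulr_suml.
rewrite big_split /= exchange_big /= [X in _ + X]exchange_big /=.
under eq_bigr => l _.
  under eq_bigr do rewrite -mulrA.
  rewrite -mulr_sumr sum_indicator_diff//; over.
under [X in _ + X]eq_bigr => j _ do rewrite sum_indicator_diff//.
(* Idle servers may be included, since [depart] fixes [x] there. *)
have -> : \sum_(j < n | (0 < x j)%N) (phi (depart x j) - phi x) =
    \sum_(j < n) (phi (depart x j) - phi x).
  rewrite [RHS](bigID (fun j => 0 < x j)%N)/= [X in _ + X]big1 ?addr0// => j.
  by rewrite -leqNgt leqn0 => /eqP/depart0 ->; rewrite subrr.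
rewrite -mulr_sumr !sumrB !sumr_const card_tuple card_ord /jump.
rewrite -[phi x *+ (n ^ d)]mulr_natr -[phi x *+ n]mulr_natr natrX.
have l1 : 1 + lam != 0 by rewrite gt_eqF ?addr_gt0.
have n1 : n%:R != 0 :> R by rewrite pnatr_eq0 -lt0n.
have nd : n%:R ^+ d != 0 :> R by rewrite expf_neq0.
by field; rewrite l1 n1 nd.
Qed.

Lemma transition_rate_near (R : realType) (lam : R) (d n : nat)
    (p : R -> R.-pker (state n) ~> (state n)) (x : state n)
    (S : seq (state n)) (e : R) :
  supermarket_transition lam d p -> 0 < e ->
  exists2 delta, 0 < delta & forall h y, 0 < h < delta -> y \in S ->
    (x == y)%:R + h * supermarket_rate lam d x y - e * h <=
    fine (p h x [set y]).
Proof.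
move=> pP e0; elim: S => [|y S [d1 d10 IHS]]; first by exists 1.
have /cvgrPdist_lt/(_ e e0)[d2 /= d20 H2] := @transition_rate _ _ _ _ _ pP x y.
exists (Num.min d1 d2) => [|h z]; first by rewrite lt_min d10.
rewrite lt_min => /and3P[h0 hd1 hd2]; rewrite inE => /orP[/eqP ->|]; last first.
  by apply: IHS; rewrite h0.
have /H2/(_ h0) : ball 0 d2 h by rewrite /ball/= sub0r normrN gtr0_norm.
move=> /(le_lt_trans (ler_norm _)); rewrite ltrBlDr -ltrBlDl ltr_pdivlMr//.
by move/ltW; lra.
Qed.

(** The short time [h] is run first, as in the backward equation. Only [p h] is approximated, so
    [delta] does not depend on [t]. *)
Lemma transition_step (R : realType) (lam : R) (d n : nat)
    (p : R -> R.-pker (state n) ~> (state n)) (A : set (state n))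
    (x : state n) (e : R) :
  0 < lam -> (0 < n)%N -> supermarket_transition lam d p -> 0 < e ->
  exists2 delta, 0 < delta & forall h t, 0 < h < delta -> 0 <= t ->
    let W y := fine (p t y A) in
    W x + h * ((1 + lam) * n%:R * (jump lam d W x - W x)) - e * h <=
    fine (p (t + h) x A).
Proof.
move=> lam0 n0 pP e0.
pose S := undup (x :: [seq arrive x l | l : d.-tuple 'I_n <- enum {: d.-tuple 'I_n}] ++
  [seq depart x j | j <- enum 'I_n]).
have uS : uniq S := undup_uniq _.
have xS : x \in S by rewrite mem_undup mem_head.
have aS (l : d.-tuple 'I_n) : arrive x l \in S.
  rewrite mem_undup inE mem_cat (map_f (fun l : d.-tuple 'I_n => arrive x l)).
    by rewrite orbT.
  by rewrite mem_enum.
have dS j : depart x j \in S.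
  by rewrite mem_undup inE mem_cat [X in _ || (_ || X)]map_f ?mem_enum// !orbT.
have sz0 : 0 < (size S)%:R :> R by rewrite ltr0n; case: S xS {uS aS dS}.
(* The error [e] is shared equally among the states of [S]; each weight [W y] is at most 1. *)
have [|delta delta0 H] := @transition_rate_near R lam d n p x S (e / (size S)%:R) pP.
  by rewrite divr_gt0.
exists delta; first exact: delta0.
move=> h t hd t0; pose W y := fine (p t y A).
change (W x + h * ((1 + lam) * n%:R * (jump lam d W x - W x)) - e * h <=
  fine (p (t + h) x A)).
have h0 : 0 <= h by case/andP: hd => /ltW.
rewrite [t + h]addrC.
apply: le_trans (transition_ge_sum A x pP h0 t0 uS).
rewrite -(sum_rate W lam0 n0 uS xS aS dS).
have W01 y : 0 <= W y <= 1 := fine_kernel_le1 (p t) y A.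
have Wx : W x = \sum_(y <- S) (x == y)%:R * W y.
  rewrite (bigD1_seq x)//= eqxx mul1r big1 ?addr0// => z.
  by rewrite eq_sym => /negbTE ->; rewrite mul0r.
have se : e * h = \sum_(y <- S) e / (size S)%:R * h.
  rewrite big_const_seq count_predT iter_addr_0 -mulr_natr.
  by field; rewrite gt_eqF.
rewrite Wx se mulr_sumr -sumrN -!big_split /=.
rewrite big_seq [leRHS]big_seq; apply: ler_sum => y yS.
have /andP[w0 w1] := W01 y; have /(ler_wpM2r w0) := H h y hd yS.
apply: le_trans; set r := supermarket_rate _ _ _ _.
have eh : 0 <= e / (size S)%:R * h by rewrite mulr_ge0// ltW// divr_gt0.
have : e / (size S)%:R * h * W y <= e / (size S)%:R * h by rewrite ler_piMr.
by lra.
Qed.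

(** * Comparison with the uniformised chain *)

Lemma jump_exp_sum (R : realType) (lam : R) (d n m : nat) (s : R)
    (g : state n -> R) (x : state n) : 0 < lam -> (0 < n)%N ->
  jump lam d (fun y => \sum_(0 <= k < m)
    exp_coeff s k * iter k (jump lam d) g y) x =
  \sum_(0 <= k < m) exp_coeff s k * iter k.+1 (jump lam d) g x.
Proof.
move=> lam0 n0; elim: m => [|m IHm].
  under [X in jump _ _ X]eq_fun do rewrite big_geq//.
  by rewrite big_geq// jump_cst.
under [X in jump _ _ X]eq_fun do rewrite big_nat_recr//= addrC.
by rewrite jump_linear IHm big_nat_recr//= addrC.
Qed.

Lemma iter_jump_ge0 (R : realType) (lam : R) (d n k : nat)
    (g : state n -> R) (x : state n) : 0 < lam -> (0 < n)%N ->
  (forall y, 0 <= g y) -> 0 <= iter k (jump lam d) g x.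
Proof.
move=> lam0 n0 g0; elim: k x => //= k IHk x.
by rewrite -(jump_cst d 0 x lam0 n0); exact: ler_jump.
Qed.

(** Induction on [m]: the left side has derivative [G], while [F] grows at rate
    [q * expR (q * t) * jump lam d W x], which is at least [G t] by induction. Partial sums suffice,
    as all terms are nonnegative. *)
Lemma transition_ge_uniformized (R : realType) (lam : R) (d n m : nat)
    (p : R -> R.-pker (state n) ~> (state n)) (A : set (state n))
    (t : R) (x : state n) :
  0 < lam -> (0 < n)%N -> supermarket_transition lam d p -> 0 <= t ->
  \sum_(0 <= k < m) exp_coeff ((1 + lam) * n%:R * t) k *
    iter k (jump lam d) \1_A x <=
  expR ((1 + lam) * n%:R * t) * fine (p t x A).
Proof.
move=> lam0 n0 pP; set q := (1 + lam) * n%:R.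
have q0 : 0 < q by rewrite mulr_gt0 ?addr_gt0 ?ltr0n.
have W01 t' y : 0 <= fine (p t' y A) <= 1 := fine_kernel_le1 (p t') y A.
have K0 k y : 0 <= iter k (jump lam d) (\1_A : state n -> R) y.
  by apply: iter_jump_ge0 => // z; rewrite indicE ler0n.
elim: m t x => [|m IHm] T x T0.
  by rewrite big_geq// mulr_ge0 ?expR_ge0.
pose F t := expR (q * t) * fine (p t x A).
pose G t := q * \sum_(0 <= k < m)
  exp_coeff (q * t) k * iter k.+1 (jump lam d) \1_A x.
pose H t := \sum_(0 <= k < m.+1)
  exp_coeff (q * t) k * iter k (jump lam d) \1_A x.
apply: (@lower_primitive_bound R F G H) => //.
- move=> e e0; set E := expR (q * T).
  have E0 : 0 < E := expR_gt0 _.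
  have [|d1 d10 Hstep] := @transition_step R lam d n p A x (e / (2 * E)) lam0 n0 pP.
    by rewrite divr_gt0 ?mulr_gt0.
  have Eq20 : 0 < 2 * E * q ^+ 2 by rewrite mulr_gt0 ?exprn_gt0// mulr_gt0.
  (* The three bounds on [h] serve the short-time expansion, [q * h <= 1], and a second-order error
     of at most [e / 2 * h]. *)
  exists (Num.min d1 (Num.min q^-1 (e / (2 * E * q ^+ 2)))).
    have : 0 < e / (2 * E * q ^+ 2) by rewrite divr_gt0// Eq20.
    by rewrite !lt_min d10 invr_gt0 q0 => ->.
  move=> t h t0; rewrite !lt_min => /and4P[h0 hd1 hq he] thT.
  have := Hstep h t; rewrite h0 hd1 => /(_ isT t0) /=.
  set W := fun y => fine (p t y A); rewrite -/q -/(F t).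
  have KW : G t <= q * (expR (q * t) * jump lam d W x).
    rewrite /G ler_pM2l//.
    rewrite -jump_exp_sum// -[leRHS]addr0 -jump_affine//.
    by apply: ler_jump => // y; rewrite addr0; exact: IHm.
  have W0 : 0 <= W x <= 1 := W01 t x.
  have KW0 : 0 <= jump lam d W x.
    rewrite -(jump_cst d 0 x lam0 n0); apply: ler_jump => // y.
    by have /andP[] := W01 t y.
  rewrite /F [q * (t + h)]mulrDr expRD; set a := expR (q * t); set b := expR (q * h).
  rewrite -/(W x) => st.
  have a0 : 0 < a := expR_gt0 _.
  have aE : a * b <= E by rewrite -expRD -mulrDr ler_expR ler_pM2l.
  have b1 : 1 + q * h <= b := expR_ge1Dx _.
  have qh1 : q * h <= 1.
    by rewrite mulrC -ler_pdivlMr// mul1r ltW.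
  have qh0 : 0 <= q * h by rewrite mulr_ge0// ltW.
  have hE : E * q ^+ 2 * h <= e / 2.
    move/ltW: he; rewrite ler_pdivlMr//; lra.
  have aE1 : a <= E.
    by apply: le_trans aE; rewrite ler_peMr ?(ltW a0)//; lra.
  set J := jump lam d W x in KW KW0 st *.
  have c0 : 0 <= (1 - q * h) * W x + q * h * J.
    by case/andP: W0 => *; apply: addr_ge0; apply: mulr_ge0; rewrite ?subr_ge0.
  have ab0 : 0 <= a * b by rewrite mulr_ge0 ?expR_ge0.
  have s1 := ler_wpM2l ab0 st.
  apply: le_trans s1.
  (* Replacing [expR (q * h)] by [1 + q * h] turns the coefficient of [W x] into [1 - (q * h) ^+ 2],
     whose defect is bounded in [s4]. *)
  have s2 : a * (1 + q * h) * ((1 - q * h) * W x + q * h * J) <=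
      a * b * ((1 - q * h) * W x + q * h * J).
    by rewrite ler_wpM2r// ler_pM2l.
  have s3 : a * b * (e / (2 * E) * h) <= e / 2 * h.
    have -> : e / 2 * h = E * (e / (2 * E) * h) by field; rewrite gt_eqF.
    by rewrite ler_wpM2r// mulr_ge0 ?divr_ge0 ?mulr_ge0// ltW.
  have qq0 : 0 <= q * h * (q * h) by exact: mulr_ge0.
  have aqq0 : 0 <= a * (q * h * (q * h)) by rewrite mulr_ge0// ltW.
  have s4 : a * (q * h * (q * h)) * W x <= e / 2 * h.
    apply: (@le_trans _ _ (E * (q * h * (q * h)) * 1)).
      by case/andP: W0 => *; apply: ler_pM => //; rewrite ler_wpM2r.
    have := ler_wpM2r (ltW h0) hE; lra.
  have s5 : 0 <= a * (q * h * (q * h)) * J by exact: mulr_ge0.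
  have := ler_wpM2l (ltW h0) KW; rewrite -/a => s6.
  move: (e / (2 * E)) (W x) (G t) s2 s3 s4 s5 s6 => e' w g *; lra.
(* Termwise, [b ^+ k.+1 - a ^+ k.+1] is [b - a] times a sum of [k.+1] products, each at most
   [b ^+ k]. *)
- move=> a b a0 ab; rewrite /H /G -sumrB big_nat_recl//= /exp_coeff /=.
  rewrite !expr0 subrr add0r mulrCA mulr_sumr mulr_sumr.
  apply: ler_sum_nat => k _; rewrite -mulrBl mulrA mulrA.
  apply: ler_wpM2r; first exact: (K0 k.+1).
  rewrite -mulrBl factS natrM invfM mulrA [leRHS]mulrA.
  apply: ler_wpM2r; first by rewrite invr_ge0.
  rewrite ler_pdivrMr ?ltr0n// subrXX -mulrBr -[leRHS]mulrA.
  have qb : 0 <= q * b by rewrite mulr_ge0 ?(ltW q0)// (le_trans a0).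
  apply: ler_wpM2l; first by rewrite mulr_ge0 ?subr_ge0// ltW.
  rewrite mulr_natr -[X in _ *+ X]card_ord -sumr_const.
  apply: ler_sum => -[i /= ik] _.
  rewrite -[in leRHS](@subnK i k)// exprD; apply: ler_wpM2l.
    by rewrite exprn_ge0.
  have qa : 0 <= q * a by rewrite mulr_ge0 // ltW.
  by apply: lerXn2r; rewrite ?nnegrE ?ler_pM2l.
- rewrite mulr_ge0 ?(ltW q0)// mulr0 sumr_ge0// => k _.
  apply: mulr_ge0; last exact: (K0 k.+1).
  by rewrite /exp_coeff/= divr_ge0// exprn_ge0.
- rewrite /H /F mulr0 expR0 mul1r big_nat_recl//= big1 ?addr0.
    rewrite /exp_coeff /= expr0 invr1 !mul1r indicE.
    have [xA|xA] := boolP (x \in A); last by have /andP[] := W01 0 x.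
    rewrite -lee_fin kernel_fineK -(transition0 pP x).
    by apply: le_measure; rewrite ?inE//= => _ ->; exact: set_mem.
  by move=> k _; rewrite /exp_coeff /= expr0n mul0r mul0r.
Qed.

(** * Law at time [t] and stationary law *)

(** Cutting [A] along the [pickle] codes gives countably many pieces, each a singleton or empty. *)
Lemma measure_state_ext (R : realType) (n : nat)
    (mu nu : {measure set (state n) -> \bar R}) :
  (forall y, mu [set y] = nu [set y]) -> forall A, mu A = nu A.
Proof.
move=> munu A; pose F k := [set y | A y /\ pickle y = k].
have -> : A = \bigcup_(k in setT) F k.
  by apply/seteqP; split => [y Ay|y [k _ []]//]; exists (pickle y).
have trF : trivIset setT F.
  apply/trivIsetP => i j _ _ /eqP ij; apply/seteqP; split => // y [[_ yi] [_ yj]].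
  by case: ij; rewrite -yi -yj.
rewrite !measure_bigcup//; apply: eq_eseriesr => k _.
have [[y Fy]|] := pselect (exists y, F k y).
  suff -> : F k = [set y] by [].
  apply/seteqP; split => [z [_ zk]|z -> //] /=.
  by apply: (pcan_inj pickleK); rewrite zk; case: Fy.
move=> nF; suff -> : F k = set0 by rewrite !measure0.
by apply/seteqP; split => // z Fz; apply: nF; exists z.
Qed.

Lemma law_from_empty (R : realType) (lam : R) (d n : nat)
    (p : R -> R.-pker (state n) ~> (state n)) (disp : measure_display)
    (Omega : measurableType disp) (P : probability Omega R)
    (X : R -> {RV P >-> state n}) (t : R) (A : set (state n)) :
  supermarket_process lam d p X -> (forall w, X 0 w = empty_state n) ->
  0 <= t -> distribution P (X t) A = p t (empty_state n) A.
Proof.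
move=> [_ XP _] X0 t0.
apply: (@measure_state_ext _ _ (distribution P (X t)) (p t (empty_state n))) => y.
pose s i : R := if i == 0%N then 0 else t.
pose x i := if i == 0%N then empty_state n else y.
have s_homo : {homo s : i j / (i <= j)%N >-> i <= j} by move=> [|i] [|j].
have := XP 1%N s x erefl s_homo; rewrite big_nat1 /s /x /= subr0.
have -> : [set w | X 0 w = empty_state n] = setT.
  by apply/seteqP; split => // w _; exact: X0.
rewrite probability_setT mul1e => <-.
rewrite /distribution /= /pushforward; congr (P _).
apply/seteqP; split => w /=; first by move=> Xt [|[|i]]//= _.
by move=> /(_ 1%N (leqnn _)).
Qed.

(** A bound uniform in the initial state survives averaging over [Pi]; invariance is all that is
    asked of [Pi]. *)
Lemma stationary_ge (R : realType) (n : nat)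
    (p : R -> R.-pker (state n) ~> (state n)) (Pi : probability (state n) R)
    (t c : R) (A : set (state n)) :
  stationary p Pi -> 0 <= t -> (forall x, c <= fine (p t x A)) ->
  (c%:E <= Pi A)%E.
Proof.
move=> st t0 pc; have [c0|c0] := ltP c 0.
  by rewrite (le_trans _ (measure_ge0 _ _))// lee_fin ltW.
rewrite -(st t A t0) -[leLHS]mule1 -(probability_setT Pi) -integral_cst//.
apply: ge0_le_integral => //.
by move=> x _; rewrite /cst -kernel_fineK lee_fin.
Qed.

(** * Concentration and separation of the two laws *)

(** The indicator of [C] is below [expR (beta * f y - c)]. The sign of [beta] is free, so both tails
    are covered. *)
Lemma iter_jump_chernoff (R : realType) (lam beta c : R) (d n k : nat)
    (f : state n -> R) (C : set (state n)) (x : state n) :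
  0 < lam -> (0 < d)%N -> (0 < n)%N -> `|beta| <= 1 / 2 -> increments_in 1 f ->
  (forall y, C y -> c <= beta * f y) ->
  iter k (jump lam d) \1_C x <=
  expR (beta * iter k (jump lam d) f x - c + k%:R * (2 * beta ^+ 2)).
Proof.
move=> lam0 d0 n0 b2 f1 Cc.
apply: (@le_trans _ _ (iter k (jump lam d)
    (fun y => expR (- c) * expR (beta * f y) + 0) x)).
  apply: ler_iter_jump => // y; rewrite addr0 -expRD indicE.
  have [yC|yC] := boolP (y \in C); last exact: expR_ge0.
  apply: le_trans (expR_ge1Dx _).
  by have := Cc y (set_mem yC); rewrite /=; lra.
rewrite iter_jump_affine// addr0.
apply: le_trans (ler_wpM2l (expR_ge0 _) (iter_jump_expR k x lam0 d0 n0 b2 f1)) _.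
by rewrite -expRD ler_expR; lra.
Qed.

(** Inside the window each iterate of the indicator of [A] is at least [1 - e]; the Poisson weight
    of the window is at most 1, so the loss is at most [e]. *)
Lemma transition_ge_window (R : realType) (lam : R) (d n l m : nat)
    (p : R -> R.-pker (state n) ~> (state n)) (A : set (state n))
    (t e : R) (x : state n) :
  0 < lam -> (0 < n)%N -> supermarket_transition lam d p -> 0 <= t ->
  (l <= m)%N -> 0 <= e ->
  (forall k, (l <= k < m)%N -> iter k (jump lam d) \1_(~` A) x <= e) ->
  expR (- ((1 + lam) * n%:R * t)) *
    (\sum_(l <= k < m) exp_coeff ((1 + lam) * n%:R * t) k) - e <=
  fine (p t x A).
Proof.
move=> lam0 n0 pP t0 lm e0 Ke; set s := (1 + lam) * n%:R * t.
have s0 : 0 <= s by rewrite !mulr_ge0// addr_ge0// ltW.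
have c0 k : 0 <= exp_coeff s k by rewrite /exp_coeff/= divr_ge0 ?exprn_ge0.
have := transition_ge_uniformized m A x lam0 n0 pP t0; rewrite -/s.
have KA0 k : 0 <= iter k (jump lam d) (\1_A : state n -> R) x.
  by apply: iter_jump_ge0 => // z; rewrite indicE ler0n.
set w := \sum_(l <= k < m) _ => h.
have w1 : w <= expR s.
  apply: le_trans (sum_exp_coeff_le m s0); rewrite (big_cat_nat (leq0n l) lm)//=.
  by rewrite lerDr sumr_ge0.
have {}h : w * (1 - e) <= expR s * fine (p t x A).
  apply: le_trans h; rewrite (big_cat_nat (leq0n l) lm)//=.
  rewrite -[leLHS]add0r lerD//; first by rewrite sumr_ge0// => k _; rewrite mulr_ge0.
  rewrite mulr_suml; apply: ler_sum_nat => k klm; apply: ler_wpM2l => //.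
  have -> : (\1_A : state n -> R) = fun y => (-1) * \1_(~` A) y + 1.
    apply/funext => y; rewrite !indicE in_setC.
    by case: (y \in A) => /=; rewrite ?mulr0 ?mulr1; lra.
  by rewrite iter_jump_affine//; have := Ke k klm; lra.
have e1 : expR (- s) * expR s = 1 by rewrite -expRD addNr expR0.
have {h} := ler_wpM2l (expR_ge0 (- s)) h.
rewrite [X in _ <= X]mulrA e1 mul1r; apply: le_trans.
have : expR (- s) * w * e <= e.
  by rewrite ler_piMl// -e1 ler_wpM2l ?expR_ge0.
by lra.
Qed.

Lemma dTV_ge_of_windows (R : realType) (lam beta t : R) (d n M M' : nat)
    (p : R -> R.-pker (state n) ~> (state n))
    (disp : measure_display) (Omega : measurableType disp)
    (P : probability Omega R) (X : R -> {RV P >-> state n})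
    (Pi : probability (state n) R) :
  let a k := iter k (jump lam d) (fun x : state n => (customers x)%:R)
               (empty_state n) in
  0 < lam -> (0 < d)%N -> (0 < n)%N -> 0 <= beta -> beta <= 1 / 2 ->
  supermarket_process lam d p X -> (forall w, X 0 w = empty_state n) ->
  stationary p Pi -> 0 <= t -> (1 + lam) * n%:R * t <= M%:R / 4 ->
  (M <= M')%N ->
  ((1 - (2 * expR (- M'%:R) + expR (- (M%:R / 4)) +
         2 * expR (20 * M'%:R * beta ^+ 2 - beta * (a M' - a M) / 2)))%:E <=
   dTV (distribution P (X t)) Pi)%E.
Proof.
move=> a lam0 d0 n0 b0 b2 XP X0 st t0 tM MM'; set eps := beta * _ / 2.
have pP := process_transition XP.
pose f (x : state n) : R := (customers x)%:R.
have f1 : increments_in 1 f := @customers_increments R n.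
have a_mono i j : (i <= j)%N -> a i <= a j.
  move=> /subnKC <-; have := @iter_jump_empty_gap R lam d n i (j - i) f lam0 d0 n0 f1.
  apply: le_trans; rewrite lerDl mulr_ge0// mulr_ge0 ?exprn_ge0 ?avoidance_ge0//.
  by rewrite divr_ge0 ?ltW ?addr_gt0.
(* At the midpoint both deviations are at least half the gap, hence the same [eps] for both laws. *)
pose m := (a M + a M') / 2; pose A := [set x | m <= f x].
have nb : `|beta| <= 1 / 2 by rewrite ger0_norm.
have nnb : `|- beta| <= 1 / 2 by rewrite normrN.
(* At most [10 * M'] steps are considered, each costing [2 * beta ^+ 2]. *)
set e := expR (20 * M'%:R * beta ^+ 2 - eps).
have e0 : 0 <= e := expR_ge0 _.
have bb0 : 0 <= beta ^+ 2 := sqr_ge0 _.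
have half : 2^-1 <= expR (- (1 / 2)) :> R.
  by apply: le_trans (expR_ge1Dx _); lra.
have pow2 N : 2 ^- N <= expR (- (N%:R / 2)) :> R.
  rewrite -exprVn (_ : - (N%:R / 2) = N%:R * (- (1 / 2))); last by lra.
  by rewrite expRM_natl lerXn2r ?nnegrE ?expR_ge0// invr_ge0.
have low : 1 - expR (- (M%:R / 4)) - e <= fine (p t (empty_state n) (~` A)).
  have Ke k : (0 <= k < M)%N ->
      iter k (jump lam d) \1_(~` ~` A) (empty_state n) <= e.
    move=> /andP[_ kM]; rewrite setCK.
    apply: le_trans (@iter_jump_chernoff R lam beta (beta * m) d n k f A _
      lam0 d0 n0 nb f1 _) _.
      by move=> y Ay; rewrite ler_wpM2l.
    rewrite ler_expR.
    have h1 := ler_wpM2l b0 (a_mono k M (ltnW kM)).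
    have h2 : k%:R * beta ^+ 2 <= M'%:R * beta ^+ 2.
      by rewrite ler_wpM2r// ler_nat (leq_trans (ltnW kM)).
    have h3 : 0 <= M'%:R * beta ^+ 2 by rewrite mulr_ge0.
    by rewrite -/(a k) /eps /m; lra.
  apply: le_trans (transition_ge_window lam0 n0 pP t0 (leq0n M) e0 Ke).
  rewrite lerD2r; set s := _ * t in tM *.
  have s0 : 0 <= s by rewrite !mulr_ge0// addr_ge0// ltW.
  have e1 : expR (- s) * expR s = 1 by rewrite -expRD addNr expR0.
  apply: le_trans (ler_wpM2l (expR_ge0 _) (sum_exp_coeff_ge M s0)).
  rewrite mulrBr e1 lerD2l lerN2 mulrCA -expRD.
  apply: le_trans (ler_wpM2r (expR_ge0 _) (pow2 M)) _.
  by rewrite -expRD ler_expR; lra.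
(* At this time the Poisson number of steps has mean 4 M', and so lies between
   M' and 10 M' except with probability 2 e^(- M'). *)
pose t' := 4 * M'%:R / ((1 + lam) * n%:R).
have q0 : 0 < (1 + lam) * n%:R by rewrite mulr_gt0 ?ltr0n ?addr_gt0.
have t'0 : 0 <= t' by apply: divr_ge0; [exact: mulr_ge0|exact: ltW].
have qt' : (1 + lam) * n%:R * t' = 4 * M'%:R by rewrite mulrC divfK// gt_eqF.
have high : ((1 - 2 * expR (- M'%:R) - e)%:E <= Pi A)%E.
  apply: (stationary_ge st t'0) => x.
  (* Staying below [m] is a lower deviation, hence [- beta]. *)
  have Ke k : (M' <= k < 10 * M')%N -> iter k (jump lam d) \1_(~` A) x <= e.
    move=> /andP[Mk kM].
    apply: le_trans (@iter_jump_chernoff R lam (- beta) (- beta * m) d n k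
      f (~` A) _ lam0 d0 n0 nnb f1 _) _.
      by move=> y /negP; rewrite -ltNge => /ltW ym; rewrite !mulNr lerN2 ler_wpM2l.
    rewrite ler_expR sqrrN.
    have h1 := ler_wpM2l b0 (le_trans (a_mono M' k Mk)
      (iter_jump_ge_empty k x lam0 d0 f1)).
    have h2 : k%:R * beta ^+ 2 <= 10 * M'%:R * beta ^+ 2.
      by rewrite ler_wpM2r// -natrM ler_nat ltnW.
    by rewrite /eps /m; lra.
  have M10 : (M' <= 10 * M')%N by rewrite leq_pmull.
  apply: le_trans (transition_ge_window lam0 n0 pP t'0 M10 e0 Ke).
  rewrite qt' lerD2r.
  have s0 : 0 <= 4 * M'%:R :> R by rewrite mulr_ge0.
  apply: le_trans (poisson_window s0 M10).
  (* Lower tail: [2 <= expR 1] against [expR (- 2 M')]. Upper tail: [2 ^- (10 M') <= expR (- 5 M')]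
     against [expR (4 M')]. *)
  have p1 : 2 ^+ M' * expR (- (4 * M'%:R / 2)) <= expR (- M'%:R) :> R.
    have : 2 ^+ M' <= expR M'%:R :> R.
      rewrite -[in expR _](mulr1 M'%:R) expRM_natl lerXn2r ?nnegrE ?expR_ge0//.
      by apply: le_trans (expR_ge1Dx _); lra.
    move=> /(ler_wpM2r (expR_ge0 (- (4 * M'%:R / 2)))) /le_trans; apply.
    by rewrite -expRD ler_expR; lra.
  have p2 : 2 ^- (10 * M') * expR (4 * M'%:R) <= expR (- M'%:R) :> R.
    apply: le_trans (ler_wpM2r (expR_ge0 _) (pow2 _)) _.
    by rewrite -expRD ler_expR natrM; lra.
  by lra.
rewrite /dTV; apply: ereal_sup_ge.
exists `|distribution P (X t) A - Pi A|%E; first by exists A.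
rewrite (law_from_empty A XP X0 t0) -kernel_fineK.
have PiA : (fine (Pi A))%:E = Pi A by rewrite fineK// fin_num_measure.
move: high; rewrite -PiA -EFinB abse_EFin !lee_fin => high.
rewrite distrC; apply: le_trans (ler_norm _).
by move: low; rewrite fine_kernelC; lra.
Qed.

(** * Choice of the constants *)

(** For [n >= 2], [n / (n - 1) <= 1 + 2 / n <= expR (2 / n)]. *)
Lemma avoidance_ge_expR (R : realType) (d n k : nat) : (2 <= n)%N ->
  expR (- (2 * (d * k)%:R / n%:R)) <= avoidance R d n ^+ k.
Proof.
move=> n2; have n0 : 0 < n%:R :> R by rewrite ltr0n (leq_trans _ n2).
have n2R : 2 <= n%:R :> R by rewrite (ler_nat _ 2).
rewrite /avoidance -exprM.
rewrite (_ : - (2 * (d * k)%:R / n%:R) = (d * k)%:R * (- (2 / n%:R))); last by lra.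
rewrite expRM_natl lerXn2r ?nnegrE ?expR_ge0 ?divr_ge0//.
rewrite -subn1 natrB ?(leq_trans _ n2)// expRN -ler_pV2; first last.
- by rewrite inE unitf_gt0 ?invr_gt0 ?expR_gt0.
- have h : 0 < (n%:R - 1) / n%:R :> R by rewrite divr_gt0// subr_gt0; lra.
  by rewrite inE unitf_gt0 h.
rewrite invrK invf_div; apply: le_trans (expR_ge1Dx _).
rewrite ler_pdivrMr; last by lra.
have -> : (1 + 2 / n%:R) * (n%:R - 1) = n%:R + (1 - 2 / n%:R) :> R.
  by field; rewrite gt_eqF.
by rewrite lerDl subr_ge0 ler_pdivrMr// mul1r.
Qed.

Lemma expR_ge_cube (R : realType) (z : R) : 0 <= z -> z ^+ 3 <= expR (3 * z).
Proof.
move=> z0; rewrite expRM_natl; apply: lerXn2r; rewrite ?nnegrE ?expR_ge0//.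
by apply: le_trans (expR_ge1Dx _); lra.
Qed.

Theorem mainTheorem2 (R : realType) (lam : R) (d : nat)
    (lam_gt0 : 0 < lam) (lam_lt1 : lam < 1) (d_gt0 : (0 < d)%N) :
  exists (theta gamma : R) (n0 : nat),
    [/\ 0 < theta, 0 < gamma &
     forall (n : nat) (p : R -> R.-pker (state n) ~> (state n))
       (disp : measure_display) (Omega : measurableType disp)
       (P : probability Omega R) (X : R -> {RV P >-> state n})
       (Pi : probability (state n) R),
     (n0 <= n)%N ->
     supermarket_process lam d p X ->
     (forall w : Omega, X 0 w = empty_state n) ->
     stationary p Pi ->
     forall t : R, 0 <= t -> t <= theta * ln n%:R ->
     ((1 - expR (- (gamma * ln n%:R ^+ 2)))%:E <=
        dTV (distribution P (X t)) Pi)%E].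
Proof.
pose D : R := d%:R.
have D1 : 1 <= D by rewrite /D (ler_nat _ 1).
(* Chosen so that [2 * D * (eta * L) = L / 8]. *)
pose eta := (16 * D)^-1.
have D0 : 0 < D by lra.
have eta0 : 0 < eta by rewrite invr_gt0 mulr_gt0.
have etaD : eta * D = 1 / 16 by rewrite /eta; field; rewrite gt_eqF.
have eta1 : eta <= 1.
  by rewrite invf_le1 ?mulr_gt0//; lra.
pose alpha := lam / (1 + lam).
have alpha0 : 0 < alpha by rewrite divr_gt0// addr_gt0.
pose c := alpha / 2 * expR (- (4 * D)).
have c0 : 0 < c by rewrite mulr_gt0 ?expR_gt0// divr_gt0.
(* The summands serve [beta <= 1 / 2], the bound [cube], and [80 <= l]. *)
pose L0 := 2 + 65 * 512 / c + 80 / eta.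
have cL0 : 0 < 65 * 512 / c.
  by apply: divr_gt0 (mulr_gt0 _ _) c0; rewrite ltr0n.
have eL0 : 0 < 80 / eta by rewrite divr_gt0.
have L0c : 65 * 512 / c <= L0 by rewrite /L0; lra.
have L0e : 80 / eta <= L0 by rewrite /L0; lra.
have L02 : 2 <= L0 by rewrite /L0; lra.
(* As [1 + lam <= 2], the mean number of steps is at most [n * eta * L / 4], hence at most
   [M / 4]. *)
exists (eta / 8), 1, (Num.trunc (expR L0)).+1.
split; [by rewrite divr_gt0|exact: ltr01|].
move=> n p disp Omega P X Pi nn XP X0 st t t0 tn.
have n0L : expR L0 < n%:R.
  by apply: lt_le_trans (truncnS_gt _) _; rewrite ler_nat.
have nR0 : 0 < n%:R :> R := lt_trans (expR_gt0 _) n0L.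
have n_gt0 : (0 < n)%N by rewrite -(ltr0n R).
set L := ln n%:R in tn *.
have nE : n%:R = expR L by rewrite lnK.
have LL0 : L0 <= L by rewrite -ler_expR -nE ltW.
have L2 : 2 <= L := le_trans L02 LL0.
have n2 : (2 <= n)%N.
  rewrite -(ler_nat R) nE; apply: le_trans (expR_ge1Dx _); lra.
have Lc : 65 * 512 <= c * L.
  by have := le_trans L0c LL0; rewrite ler_pdivrMr// [c * L]mulrC.
have Le : 80 <= eta * L.
  by have := le_trans L0e LL0; rewrite ler_pdivrMr// [eta * L]mulrC.
pose l := (Num.trunc (eta * L)).+1.
have l_gt : eta * L < l%:R by exact: truncnS_gt.
have l_le : l%:R <= eta * L + 1.
  by rewrite /l -natr1 lerD2r truncn_le; lra.
pose M := (n * l)%N; pose M' := (M + n)%N.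
have MR : M%:R = n%:R * l%:R :> R by rewrite natrM.
have M'R : M'%:R = n%:R * (l%:R + 1) :> R by rewrite natrD MR mulrDr mulr1.
pose beta := expR (- (L / 2)).
have beta2 : beta ^+ 2 = n%:R^-1.
  by rewrite nE -expRN /beta expr2 -expRD; congr expR; lra.
have beta_half : beta <= 1 / 2.
  have h : expR (- 1) <= 1 / 2 :> R.
    have := expR_ge1Dx (1 : R); have e1 : expR 1 * expR (-1) = 1 :> R.
      by rewrite -expRD subrr expR0.
    by have := expR_gt0 (-1 : R); nra.
  by apply: le_trans h; rewrite ler_expR; lra.
have tM : (1 + lam) * n%:R * t <= M%:R / 4.
  apply: (@le_trans _ _ (2 * n%:R * (eta / 8 * L))).
    apply: ler_pM => //; first by rewrite mulr_ge0 ?addr_ge0 ?(ltW lam_gt0)// ltW.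
    by rewrite ler_pM2r//; lra.
  have := ler_wpM2l (ltW nR0) (ltW l_gt); rewrite -MR; lra.
have := @dTV_ge_of_windows R lam beta t d n M M' p disp Omega P X Pi
  lam_gt0 d_gt0 n_gt0 (expR_ge0 _) beta_half XP X0 st t0 tM (leq_addr _ _).
apply: le_trans; rewrite lee_fin lerD2l lerN2 mul1r.
set a0 := iter M' _ _ _; set a1 := iter M _ _ _.
(* The exponent [2 * D * (l + 1)] is at most [2 * D * (eta * L + 2) = L / 8 + 4 * D], so the gap is
   of order [n ^ (7/8)]. *)
have gap : n%:R * (alpha * expR (- (L / 8 + 4 * D))) <= a0 - a1.
  rewrite lerBrDl; apply: le_trans (@iter_jump_empty_gap R lam d n M n _ lam_gt0 d_gt0
    n_gt0 (@customers_increments R n)).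
  rewrite lerD2l; apply: ler_wpM2l => //; rewrite ler_pM2l//.
  apply: le_trans (avoidance_ge_expR R d _ n2); rewrite ler_expR lerN2.
  rewrite natrM -/M' M'R -/D.
  have -> : 2 * (D * (n%:R * (l%:R + 1))) / n%:R = 2 * D * (l%:R + 1).
    by field; rewrite gt_eqF.
  have := ler_wpM2l (ltW D0) l_le; have := congr1 (fun z => z * L) etaD.
  by rewrite /=; lra.
have epsc : c * expR (3 * (L / 8)) <= beta * (a0 - a1) / 2.
  have := ler_wpM2l (expR_ge0 (- (L / 2))) gap; rewrite -/beta.
  have -> : beta * (n%:R * (alpha * expR (- (L / 8 + 4 * D)))) =
      alpha * (expR (- (4 * D)) * expR (3 * (L / 8))).
    rewrite nE /beta mulrA -expRD mulrCA -expRD -expRD.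
    by congr (_ * expR _); lra.
  by rewrite /c; lra.
(* [(L / 8) ^+ 3] is [L ^+ 3 / 512], and [c * L] is at least [65 * 512]. Of the 65, one is kept as
   the final rate; the other 64 absorb [20 * (l + 1) + 4]. *)
have cube : 65 * L ^+ 2 <= beta * (a0 - a1) / 2.
  apply: le_trans epsc.
  have L8 : 0 <= L / 8 by lra.
  apply: le_trans (ler_wpM2l (ltW c0) (expR_ge_cube L8)).
  have := ler_wpM2r (sqr_ge0 L) Lc.
  by rewrite exprMn exprVn !exprS expr0 !mulr1; lra.
have LL : 2 * L <= L ^+ 2 by rewrite expr2 ler_wpM2r//; lra.
have expo : 20 * M'%:R * beta ^+ 2 - beta * (a0 - a1) / 2 <= - L ^+ 2 - 4.
  have -> : 20 * M'%:R * beta ^+ 2 = 20 * (l%:R + 1).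
    by rewrite beta2 M'R; field; rewrite gt_eqF.
  have : eta * L <= L by rewrite ler_piMl//; lra.
  by lra.
have M4 : L ^+ 2 + 4 <= M%:R / 4.
  have nL : L ^+ 2 / 4 <= n%:R.
    have h : L / 2 <= expR (L / 2) by apply: le_trans (expR_ge1Dx _); lra.
    have L20 : 0 <= L / 2 by lra.
    rewrite nE [X in expR X]splitr expRD.
    by apply: le_trans (ler_pM L20 L20 h h); rewrite expr2; lra.
  have : L ^+ 2 / 4 * 80 <= M%:R.
    rewrite MR; apply: ler_pM => //; first by rewrite divr_ge0 ?sqr_ge0.
    by rewrite (le_trans Le)// ltW.
  by lra.
have MM' : M%:R <= M'%:R :> R by rewrite ler_nat leq_addr.
(* The errors are five copies of at most [E], and [expR 4 >= 5]. *)
set E := expR (- L ^+ 2 - 4).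
have E1 : expR (- M'%:R) <= E by rewrite ler_expR; have := ler0n R M; lra.
have E2 : expR (- (M%:R / 4)) <= E by rewrite ler_expR; lra.
have E3 : expR (20 * M'%:R * beta ^+ 2 - beta * (a0 - a1) / 2) <= E.
  by rewrite ler_expR.
have E5 : 5 * E <= expR (- L ^+ 2).
  have -> : expR (- L ^+ 2) = expR 4 * E by rewrite -expRD; congr expR; lra.
  rewrite ler_wpM2r ?expR_ge0//; apply: le_trans (expR_ge1Dx _); lra.
by lra.
Qed.
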